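(* Let $X$ be a vector space equipped with two norms $\|\cdot\|_1$ and $\|\cdot\|_2$, let $(Y,\|\cdot\|_Y)$ be a normed space, let $B := \{u\in X : \|u\|_1 \leq 1\}$, and let $T : X \to Y$ be a linear operator. Assume that the restricted mapping $$T|_B : (B,\|\cdot\|_2) \to (Y,\|\cdot\|_Y)$$ is continuous. Then $T$ is Ehrling continuous with the pair $(\|\cdot\|_1,\|\cdot\|_2)$, i.e., for any $\varepsilon>0$ there exists a constant $C_\varepsilon>0$ such that $$\|Tu\|_Y \leq \varepsilon \|u\|_1 + C_\varepsilon \|u\|_2 \qquad \text{for all } u\in X.$$ Conversely, if a linear operator $T : X\to Y$ is Ehrling continuous with the pair $(\|\cdot\|_1,\|\cdot\|_2)$, then the restricted mapping $T|_B : (B,\|\cdot\|_2)\to (Y,\|\cdot\|_Y)$ is continuous.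
   Context: No comparability between the two norms $\|\cdot\|_1$ and $\|\cdot\|_2$ on $X$ is assumed. For a norm $\|\cdot\|$ on $X$ and a subset $B\subset X$, $(B,\|\cdot\|)$ denotes the metric space $B$ with metric $d(u,v)=\|u-v\|$. Ehrling continuity: a linear operator $T: X\to Y$ is said to be Ehrling continuous with the pair $(\|\cdot\|_1,\|\cdot\|_2)$ if for any $\varepsilon>0$ there exists a constant $C_\varepsilon>0$ such that $\|Tu\|_Y\leq \varepsilon\|u\|_1+C_\varepsilon\|u\|_2$ for all $u\in X$. *)

(* Defs.v *)
From HB Require Import structures.
From mathcomp Require Import all_boot all_order all_algebra.
From mathcomp Require Import all_classical all_reals all_analysis.
Set Implicit Arguments.
Unset Strict Implicit.
Unset Printing Implicit Defensive.
Import Order.TTheory GRing.Theory Num.Theory.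
Import numFieldNormedType.Exports.
Local Open Scope classical_set_scope.
Local Open Scope ring_scope.

(* The scalars form an arbitrary numFieldType, which covers both real and
   complex vector spaces; as in normedModType, norms are K-valued, and
   [0 <= x] in K entails that x is real. *)
Record norm_on (K : numFieldType) (X : lmodType K) := NormOn {
  norm_fun :> X -> K;
  norm_ge0 : forall u, 0 <= norm_fun u;
  norm_eq0 : forall u, norm_fun u = 0 -> u = 0;
  norm_scale : forall (a : K) u, norm_fun (a *: u) = `|a| * norm_fun u;
  norm_triangle : forall u v, norm_fun (u + v) <= norm_fun u + norm_fun v }.

(* An alias of X, so that one space can carry several norms: the normed module
   (X, N), with the topology induced by N. *)
Definition normed_by (K : numFieldType) (X : lmodType K) (N : norm_on X) : Type
  := X.

Section normed_by.
Variables (K : numFieldType) (X : lmodType K) (N : norm_on X).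

HB.instance Definition _ := GRing.Lmodule.on (normed_by N).
HB.instance Definition _ := Lmodule_isNormed.Build K (normed_by N)
  (@norm_triangle K X N) (@norm_scale K X N) (@norm_eq0 K X N).

End normed_by.

Definition closed_unit_ball (K : numFieldType) (X : lmodType K)
  (N : norm_on X) : set X := [set u | N u <= 1].

Definition ehrling_continuous (K : numFieldType) (X : lmodType K)
    (Y : normedModType K) (N1 N2 : norm_on X) (T : X -> Y) : Prop :=
  forall eps : K, 0 < eps ->
    exists2 C : K, 0 < C & forall u : X, `|T u| <= eps * N1 u + C * N2 u.

(* Main.v *)
Require Import Defs.
From HB Require Import structures.
From mathcomp Require Import all_boot all_order all_algebra.
From mathcomp Require Import all_classical all_reals all_analysis.
Import Order.TTheory GRing.Theory Num.Theory.
Import numFieldNormedType.Exports.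
Local Open Scope classical_set_scope.
Local Open Scope ring_scope.

(** The forward direction is a rescaling. If the restriction of [T] to the unit
    ball [B] of [N1] is continuous at [0] for [N2], then for some [d > 0] it
    sends the part of [B] where [N2 v <= d] into the ball of radius [eps]. Any
    nonzero [u], divided by [t = N1 u + N2 u / d], lands in that region, so
    [`|T u| <= eps * t], which is the Ehrling inequality with [C = eps / d]
    ([ehrling_of_bounded_near0]). The sum [t] dominates both [N1 u] and
    [N2 u / d], so a single division brings both norms under their bounds.

    Conversely, for [x] and [y] in [B] the difference [x - y] has [N1]-norm at
    most [2], so the Ehrling inequality bounds [`|T x - T y|] by an arbitrarily
    small constant plus a multiple of [N2 (x - y)]; hence [T] is even uniformly
    continuous on [B] ([ehrling_uniformly_continuous]). *)

Lemma within_continuous_normP (K : numFieldType) (V W : normedModType K)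
    (A : set V) (f : V -> W) :
  {within A, continuous f} <->
  forall x, A x -> forall eps : K, 0 < eps ->
    exists2 d : K, 0 < d &
      forall y, A y -> `|x - y| < d -> `|f x - f y| < eps.
Proof.
rewrite subspace_continuousP; split=> fc x Ax.
  move=> eps eps0; have /cvgrPdist_lt/(_ eps eps0) := fc x Ax.
  rewrite near_withinE.
  by move=> /nbhs_normP [d /= d0 dP]; exists d => // y Ay xy; exact: dP.
apply/cvgrPdist_lt => eps /(fc x Ax) [d d0 dP].
rewrite near_withinE; apply/nbhs_normP; exists d => //= y xy Ay.
exact: dP.
Qed.

Section ehrling.
Variables (K : numFieldType) (X : lmodType K) (N1 N2 : norm_on X).
Variables (Y : normedModType K) (T : {linear X -> Y}).

(** Rescaling argument: any [u <> 0] is [t] times a point where the local bound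
    holds, and [t] is a combination of the two norms of [u] in which only the
    coefficient of [N2] depends on [d]. *)
Lemma ehrling_of_bounded_near0 :
  (forall eps : K, 0 < eps -> exists2 d : K, 0 < d &
     forall v, N1 v <= 1 -> N2 v <= d -> `|T v| <= eps) ->
  ehrling_continuous N1 N2 T.
Proof.
move=> T0 eps eps0; have [d d0 dP] := T0 eps eps0.
exists (eps / d) => [|u]; first by rewrite divr_gt0.
rewrite -mulrA -mulrDr; set t := N1 u + _.
have N1u := norm_ge0 N1 u.
have N2d : 0 <= d^-1 * N2 u by rewrite mulr_ge0 ?invr_ge0 ?norm_ge0// ltW.
have [->|u0] := eqVneq u 0.
  by rewrite linear0 normr0 mulr_ge0 ?addr_ge0// ltW.
have t0 : 0 < t.
  rewrite ltr_wpDr// lt_neqAle N1u andbT eq_sym.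
  by apply: contraNneq u0 => /norm_eq0 ->.
have v1 : N1 (t^-1 *: u) <= 1.
  by rewrite norm_scale gtr0_norm ?invr_gt0// mulrC ler_pdivrMr// mul1r lerDl.
have vd : N2 (t^-1 *: u) <= d.
  rewrite norm_scale gtr0_norm ?invr_gt0// mulrC ler_pdivrMr//.
  by rewrite mulrDr mulVKf ?gt_eqF// lerDr mulr_ge0// ltW.
have := dP _ v1 vd.
by rewrite linearZ normrZ gtr0_norm ?invr_gt0// mulrC ler_pdivrMr.
Qed.

(** By linearity the Ehrling inequality applies to [x - y], where the [N1] term
    is bounded on the ball and is made small by the choice of its coefficient,
    before [d] is chosen to absorb the [N2] term. *)
Lemma ehrling_uniformly_continuous : ehrling_continuous N1 N2 T ->
  forall eps : K, 0 < eps -> exists2 d : K, 0 < d &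
    forall x y, N1 x <= 1 -> N1 y <= 1 -> N2 (x - y) < d ->
      `|T x - T y| < eps.
Proof.
move=> TE eps eps0.
(* The [N1]-diameter of the ball is at most 2, so the first term of the
   Ehrling inequality costs [eps / 2]. *)
have [C C0 CP] := TE (eps / 4) (divr_gt0 eps0 (ltr0n _ 4)).
exists (eps / 2 / C) => [|x y x1 y1]; first by rewrite !divr_gt0.
rewrite ltr_pdivlMr// mulrC -linearB => xyd.
apply: (le_lt_trans (CP _)); rewrite [ltRHS]splitr ler_ltD//.
have N1xy : N1 (x - y) <= 2.
  apply: (le_trans (norm_triangle N1 x (- y))).
  by rewrite -scaleN1r norm_scale normrN1 mul1r -[2]/(1 + 1) lerD.
apply: le_trans (ler_wpM2l _ N1xy) _; first by rewrite divr_ge0// ltW.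
suff -> : eps / 4 * 2 = eps / 2 by [].
have -> : 4 = 2 * 2 :> K by rewrite -natrM.
by rewrite invfM mulrA mulfVK ?pnatr_eq0.
Qed.

End ehrling.

Theorem theorem1p6 (K : numFieldType) (X : lmodType K) (N1 N2 : norm_on X)
    (Y : normedModType K) (T : {linear X -> Y}) :
  let B : set (normed_by N2) := closed_unit_ball N1 in
  ({within B, continuous (T : normed_by N2 -> Y)} ->
     ehrling_continuous N1 N2 T) /\
  (ehrling_continuous N1 N2 T ->
     {within B, continuous (T : normed_by N2 -> Y)}).
Proof.
move=> B; split=> [/within_continuous_normP Tc|TE].
  have N0 (N : norm_on X) : N 0 = 0.
    by rewrite -(scale0r 0) norm_scale normr0 mul0r.
  apply: ehrling_of_bounded_near0 => eps eps0.
  have B0 : B 0 by rewrite /B /closed_unit_ball /= N0 ler01.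
  have [d d0 dP] := Tc 0 B0 eps eps0.
  (* Halving [d] turns the strict bound on [N2] into a weak one. *)
  exists (d / 2) => [|v v1 vd]; first by rewrite divr_gt0.
  have: `|(0 : normed_by N2) - v| < d.
    by rewrite sub0r normrN (le_lt_trans vd)// ltr_pdivrMr// ltr_pMr// ltr1n.
  by move=> /(dP v v1); rewrite linear0 sub0r normrN => /ltW.
apply/within_continuous_normP => x Bx eps eps0.
have [d d0 dP] := ehrling_uniformly_continuous _ _ _ _ _ _ TE _ eps0.
by exists d => // y By xy; exact: dP.
Qed.
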